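(* Let $n\ge 3$ and let $T=(t_{i,j})$ be an $n\times n$ real matrix satisfying $$t_{i,j}=t_{j,i}>0 \quad\text{for all } i,j,\qquad t_{i,i}=\sum_{j=1,\,j\neq i}^{n} t_{i,j}\quad (i=1,\dots,n).$$ Let $m=\min_{1\le i<j\le n} t_{i,j}$ and $M=\max_{1\le i<j\le n} t_{i,j}$. Let $t_{..}=\sum_{i,j=1}^n (1-\delta_{i,j})\,t_{i,j}$, and let $S=(s_{i,j})$ be the $n\times n$ matrix with entries $$s_{i,j}=\frac{\delta_{i,j}}{t_{i,i}}-\frac{1}{t_{..}}.$$ Then $$\|T^{-1}-S\|\le \frac{C(m,M)}{(n-1)^2}+\frac{1}{2m(n-1)^2},$$ where $$C(m,M)=\frac{M}{m^2}\cdot\frac{nM+(n-2)m}{2(n-2)m}.$$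
   Context: $\delta_{i,j}$ is the Kronecker delta. For a matrix $A=(a_{i,j})$, $\|A\|:=\max_{i,j}|a_{i,j}|$ (the entrywise maximum norm). $T^{-1}$ denotes the inverse of $T$; a matrix $T$ as in the claim is positive definite, hence invertible. *)

(* Defs.v *)
From HB Require Import structures.
From mathcomp Require Import all_boot all_order all_algebra.
From mathcomp Require Import reals matrix_normedtype.
Set Implicit Arguments.
Unset Strict Implicit.
Unset Printing Implicit Defensive.
Import Order.TTheory GRing.Theory Num.Theory.
Local Open Scope ring_scope.

(* The minimum and maximum of a finite nonempty list; the value 0 on the empty
   list is junk. *)
Definition list_min (R : realType) (s : seq R) : R :=
  \big[Num.min/head 0 s]_(x <- s) x.
Definition list_max (R : realType) (s : seq R) : R :=
  \big[Num.max/head 0 s]_(x <- s) x.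

Definition upper_entries (R : realType) (n : nat) (T : 'M[R]_n) : seq R :=
  [seq T p.1 p.2 | p : 'I_n * 'I_n <- enum {: 'I_n * 'I_n} & (p.1 < p.2)%N].

Definition offdiag_min (R : realType) (n : nat) (T : 'M[R]_n) : R :=
  list_min (upper_entries T).
Definition offdiag_max (R : realType) (n : nat) (T : 'M[R]_n) : R :=
  list_max (upper_entries T).

Definition offdiag_sum (R : realType) (n : nat) (T : 'M[R]_n) : R :=
  \sum_(i < n) \sum_(j < n) (1 - (i == j)%:R) * T i j.

Definition approx_inv (R : realType) (n : nat) (T : 'M[R]_n) : 'M[R]_n :=
  \matrix_(i < n, j < n) ((i == j)%:R / T i i - 1 / offdiag_sum T).

Definition bound_const (R : realType) (n : nat) (m M : R) : R :=
  M / m ^+ 2 * ((n%:R * M + (n%:R - 2) * m) / (2 * (n%:R - 2) * m)).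

(* Main.v *)
(** Put [F = T^-1 - S], fix a row [f] of [F], and let [p_j] be the probability
    vector [t_kj / t_jj] ([k != j]).  Since [F T = 1 - S T], each entry satisfies
    [f_j = b_j - sum_k p_j(k) f_k], where the [b_j] differ by at most
    [M / ((n-1) m)^2].  Hence the gap [max f - min f] is at most
    [max b - min b] plus [sum_k (p_c(k) - p_a(k)) f_k], with [a] and [c] the
    positions of the maximum and the minimum; the last sum is at most [theta]
    times the gap, because the total variation distance of [p_a] and [p_c] is at
    most [theta = (n M - (n-2) m) / (n M + (n-2) m)].  So the gap is at most
    [(max b - min b) / (1 - theta)], the first term of the bound.  The mean of
    [f] with weights [t_kk / t..] is [1 / (2 t..)], which turns the bound on the
    gap into a bound on the entries. *)

Require Import Defs.
From mathcomp Require Import all_boot all_order all_algebra.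
From mathcomp Require Import reals matrix_normedtype.
From mathcomp Require Import ring lra.
Set Implicit Arguments.
Unset Strict Implicit.
Unset Printing Implicit Defensive.
Import Order.TTheory GRing.Theory Num.Theory.
Local Open Scope ring_scope.

(** * Total variation distance between weight vectors *)

Lemma expectation_gap (R : realDomainType) (I : finType) (p q f : I -> R)
    (lo hi : R) :
    \sum_k p k = \sum_k q k -> (forall k, lo <= f k <= hi) ->
  \sum_k (p k - q k) * f k
    <= (\sum_(k | q k <= p k) (p k - q k)) * (hi - lo).
Proof.
move=> epq fb.
have -> : \sum_k (p k - q k) * f k = \sum_k (p k - q k) * (f k - lo).
  under [RHS]eq_bigr do rewrite mulrBr.
  by rewrite sumrB -mulr_suml sumrB epq subrr mul0r subr0.
rewrite mulr_suml [leRHS]big_mkcond; apply: ler_sum => k _ /=.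
have /andP[lof fhi] := fb k.
case: ifP => [qp|/negbT]; last rewrite -ltNge => pq.
  by apply: ler_wpM2l; rewrite ?subr_ge0 // lerB.
by rewrite mulr_le0_ge0 // ?subr_ge0 // subr_le0 ltW.
Qed.

(* As a function of [s = x * (n - x)] the difference of the two sides is affine
   and nondecreasing, and it vanishes at the largest possible value
   [s = n ^ 2 / 4]. *)
Lemma ratio_gap (R : realFieldType) (n x m M : R) :
    0 < m -> m <= M -> 1 <= x -> x <= n - 1 -> 2 < n ->
  x * M / (x * M + (n - 1 - x) * m)
    - (x - 1) * m / ((x - 1) * m + (n - x) * M)
  <= (n * M - (n - 2) * m) / (n * M + (n - 2) * m).
Proof.
move=> m0 mM x1 xn n2.
have M0 : 0 < M by apply: lt_le_trans mM.
have d1 : 0 < x * M + (n - 1 - x) * m.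
  by apply: ltr_pwDl; [apply: mulr_gt0; lra|apply: mulr_ge0; lra].
have d2 : 0 < (x - 1) * m + (n - x) * M.
  by apply: ltr_wpDl; [apply: mulr_ge0; lra|apply: mulr_gt0; lra].
have d3 : 0 < n * M + (n - 2) * m.
  by apply: addr_gt0; apply: mulr_gt0; lra.
rewrite -subr_ge0.
have -> : (n * M - (n - 2) * m) / (n * M + (n - 2) * m)
    - (x * M / (x * M + (n - 1 - x) * m)
       - (x - 1) * m / ((x - 1) * m + (n - x) * M))
  = (n - 1) * m * M * (M - m) * (n - 2 * x) ^+ 2
    / ((n * M + (n - 2) * m)
       * ((x * M + (n - 1 - x) * m) * ((x - 1) * m + (n - x) * M))).
  by field; rewrite !lt0r_neq0.
apply: divr_ge0; last by rewrite ltW ?mulr_gt0.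
apply: mulr_ge0; last exact: sqr_ge0.
by rewrite !mulr_ge0 //; lra.
Qed.

Lemma ler_ratio (R : realFieldType) (a b c d : R) :
    0 < a + b -> 0 < c + d -> 0 <= a -> 0 <= d -> a <= c -> d <= b ->
  a / (a + b) <= c / (c + d).
Proof.
move=> ab cd a0 d0 ac db.
rewrite ler_pdivrMr // mulrAC ler_pdivlMr // !mulrDr (mulrC c a) lerD2l.
by apply: ler_pM.
Qed.

Definition offdiag_weight (R : fieldType) (n : nat) (T : 'M[R]_n)
    (j k : 'I_n) : R :=
  (k != j)%:R * T k j / T j j.

Lemma sum_offdiag_weight (R : fieldType) (n : nat) (T : 'M[R]_n) (j : 'I_n)
    (P : pred 'I_n) :
  \sum_(k | P k) offdiag_weight T j k
    = (\sum_(k | P k && (k != j)) T k j) / T j j.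
Proof.
rewrite -mulr_suml big_mkcondr; congr (_ / _); apply: eq_bigr => k _.
by case: (k != j); rewrite ?mul1r ?mul0r.
Qed.

Lemma sum_card_le (R : numDomainType) (I : finType) (P : pred I) (F : I -> R)
    (c : R) :
  (forall k, P k -> F k <= c) -> \sum_(k | P k) F k <= #|P|%:R * c.
Proof. by move=> h; rewrite mulr_natl -sumr_const; apply: ler_sum. Qed.

Lemma sum_card_ge (R : numDomainType) (I : finType) (P : pred I) (F : I -> R)
    (c : R) :
  (forall k, P k -> c <= F k) -> #|P|%:R * c <= \sum_(k | P k) F k.
Proof. by move=> h; rewrite mulr_natl -sumr_const; apply: ler_sum. Qed.

Lemma natr_card_C (R : pzRingType) (n : nat) (P : pred 'I_n) :
  #|[pred k | ~~ P k]|%:R = n%:R - #|P|%:R :> R.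
Proof.
have /(congr1 (fun k => k%:R : R)) := cardC P.
by rewrite card_ord natrD => <-; rewrite addrAC subrr add0r.
Qed.

Lemma natr_card_D1 (R : pzRingType) (n : nat) (P : pred 'I_n) (a : 'I_n) :
  P a -> #|[pred k | P k & k != a]|%:R = #|P|%:R - 1 :> R.
Proof.
move=> Pa; rewrite (cardD1 a P) [a \in P]Pa natrD addrAC subrr add0r.
by congr (_%:R); apply: eq_card => k; rewrite !inE andbC.
Qed.

(** With [x] the size of [P], the masses of [P] under the two weights are [A / (A + B)] and
    [C / (C + D)], where [A], [B], [C], [D] have [x], [n - 1 - x], [x - 1], [n - x] terms. The
    difference is largest when the terms of [A] and [D] equal [M] and those of [B] and [C] equal
    [m], which is the case of [ratio_gap]. *)
Lemma weight_gap (R : realFieldType) (n : nat) (T : 'M[R]_n) (m M : R)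
    (a b : 'I_n) (P : pred 'I_n) :
    (3 <= n)%N -> 0 < m -> (forall k j, k != j -> m <= T k j <= M) ->
    (forall j, T j j = \sum_(k | k != j) T k j) -> P a -> ~~ P b ->
  \sum_(k | P k) (offdiag_weight T b k - offdiag_weight T a k)
    <= (n%:R * M - (n%:R - 2) * m) / (n%:R * M + (n%:R - 2) * m).
Proof.
move=> n3 m0 Tb Td Pa Pb.
have ab : a != b by apply: contraNneq Pb => <-.
have mM : m <= M by have /andP[h1 h2] := Tb _ _ ab; apply: le_trans h2.
have M0 : 0 < M by apply: lt_le_trans mM.
have n2 : 2 < n%:R :> R by rewrite (ltr_nat R 2).
pose x : R := #|P|%:R.
have cPa := natr_card_D1 R Pa; have cC := natr_card_C R P.
have cPb := @natr_card_D1 R _ [pred k | ~~ P k] b Pb.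
have x1 : 1 <= x by rewrite -subr_ge0 /x -cPa.
have xn : x <= n%:R - 1.
  have := ler0n R #|[pred k | ~~ P k & k != b]|; rewrite cPb cC /x; lra.
rewrite sumrB !sum_offdiag_weight.
have -> : T b b = \sum_(k | P k && (k != b)) T k b
                  + \sum_(k | ~~ P k && (k != b)) T k b.
  rewrite Td (bigID P) /=.
  by congr (_ + _); apply: eq_bigl => k; rewrite andbC.
have -> : T a a = \sum_(k | P k && (k != a)) T k a
                  + \sum_(k | ~~ P k && (k != a)) T k a.
  rewrite Td (bigID P) /=.
  by congr (_ + _); apply: eq_bigl => k; rewrite andbC.
have eb : (fun k => P k && (k != b)) =1 P.
  by move=> k; case: eqVneq => [->|_]; rewrite ?andbT // (negbTE Pb).
have ea : (fun k => ~~ P k && (k != a)) =1 (fun k => ~~ P k).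
  by move=> k; case: eqVneq => [->|_]; rewrite ?andbT // Pa.
rewrite (eq_bigl _ _ eb) (eq_bigl _ _ ea).
set A := \sum_(k | P k) _; set B := \sum_(k | ~~ P k && (k != b)) _.
set C := \sum_(k | P k && (k != a)) _; set D := \sum_(k | ~~ P k) _.
have lA : A <= x * M.
  apply: sum_card_le => k Pk.
  have kb : k != b by apply: contraNneq Pb => <-.
  by have /andP[] := Tb _ _ kb.
(* [lA'] and [lD'] only provide the signs that [ler_ratio] asks for. *)
have lA' : x * m <= A.
  apply: sum_card_ge => k Pk.
  have kb : k != b by apply: contraNneq Pb => <-.
  by have /andP[] := Tb _ _ kb.
have lB : (n%:R - 1 - x) * m <= B.
  have -> : n%:R - 1 - x = n%:R - x - 1 by ring.
  rewrite -cC -cPb; apply: sum_card_ge => k /andP[_ kb].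
  by have /andP[] := Tb _ _ kb.
have lC : (x - 1) * m <= C.
  rewrite -cPa; apply: sum_card_ge => k /andP[_ ka].
  by have /andP[] := Tb _ _ ka.
have neqa k : ~~ P k -> k != a by apply: contraNneq => ->.
have lD : D <= (n%:R - x) * M.
  rewrite -cC; apply: sum_card_le => k /neqa ka.
  by have /andP[] := Tb _ _ ka.
have lD' : (n%:R - x) * m <= D.
  rewrite -cC; apply: sum_card_ge => k /neqa ka.
  by have /andP[] := Tb _ _ ka.
have p0 : 0 < x * m by apply: mulr_gt0; lra.
have p1 : 0 <= (n%:R - 1 - x) * m by apply: mulr_ge0; lra.
have p2 : 0 <= (x - 1) * m by apply: mulr_ge0; lra.
have p3 : 0 < (n%:R - x) * m by apply: mulr_gt0; lra.
apply: le_trans (ratio_gap m0 mM x1 xn n2).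
by apply: lerB; apply: ler_ratio; lra.
Qed.

(** * Contraction estimate for the linear system *)

(** The right-hand side is kept general for two uses: [b = 0] gives invertibility of [T], and the
    rows of [F] give the main estimate. *)
Lemma solution_spread (R : realFieldType) (n : nat) (T : 'M[R]_n) (m M D : R)
    (u b : 'I_n -> R) :
    (3 <= n)%N -> 0 < m -> (forall k j, k != j -> m <= T k j <= M) ->
    (forall j, T j j = \sum_(k | k != j) T k j) ->
    (forall j, 0 < T j j) ->
    (forall j, \sum_k u k * T k j = T j j * b j) ->
    (forall j l, b j - b l <= D) ->
  forall j l,
    u j - u l <= D * ((n%:R * M + (n%:R - 2) * m) / (2 * (n%:R - 2) * m)).
Proof.
move=> n3 m0 Tb Td T0 uT bD i0 l0.
have n2 : 2 < n%:R :> R by rewrite (ltr_nat R 2).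
have D0 : 0 <= D by have := bD i0 i0; rewrite subrr.
case: (@Order.TotalTheory.arg_maxP _ _ _ i0 predT u isT) => a _ amax.
case: (@Order.TotalTheory.arg_minP _ _ _ i0 predT u isT) => c _ cmin.
have amax' k : u k <= u a by apply: amax.
have cmin' k : u c <= u k by apply: cmin.
apply: (@le_trans _ _ (u a - u c)); first by apply: lerB.
(* If [a = c] the gap is zero and only the sign of the bound matters; otherwise [a] and [c] can be
   separated by a set, as [weight_gap] requires. *)
have [eac|nac] := eqVneq a c.
  have n10 : (0 < n)%N by apply: leq_trans n3.
  have mM : m <= M.
    have i1 : (1 < n)%N by apply: leq_trans n3.
    have /andP[h1 h2] := Tb (Ordinal i1) (Ordinal n10) isT; exact: le_trans h2.
  rewrite eac subrr; apply: mulr_ge0 => //; apply: divr_ge0.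
    by apply: addr_ge0; apply: mulr_ge0; lra.
  by rewrite !mulr_ge0 //; lra.
have mM : m <= M by have /andP[h1 h2] := Tb _ _ nac; apply: le_trans h2.
have uE j : u j = b j - \sum_k offdiag_weight T j k * u k.
  apply: (mulfI (lt0r_neq0 (T0 j))); rewrite mulrBr -uT (bigD1 j) //= mulr_sumr.
  rewrite [X in _ - X](bigD1 j) //= /offdiag_weight eqxx !mul0r mulr0 add0r.
  rewrite mulrC -addrA -sumrB big1 ?addr0 // => k kj.
  by rewrite kj mul1r; field; rewrite lt0r_neq0.
have w1 j : \sum_k offdiag_weight T j k = 1.
  by rewrite sum_offdiag_weight /= -Td divff // lt0r_neq0.
have wd j : offdiag_weight T j j = 0 by rewrite /offdiag_weight eqxx !mul0r.
have wp j k : k != j -> 0 < offdiag_weight T j k.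
  move=> kj; rewrite /offdiag_weight kj mul1r divr_gt0 //.
  by have /andP[h _] := Tb _ _ kj; apply: lt_le_trans h.
have gap := @expectation_gap _ _ (offdiag_weight T c) (offdiag_weight T a) u
  (u c) (u a) (etrans (w1 c) (esym (w1 a)))
  (fun k => introT andP (conj (cmin' k) (amax' k))).
(* This set realises the total variation distance. It contains [a] because [p_a] vanishes there, and
   omits [c] because [p_c] vanishes there while [p_a] does not. *)
have := @weight_gap _ _ T m M a c
  (fun k => offdiag_weight T a k <= offdiag_weight T c k) n3 m0 Tb Td.
rewrite !wd (ltW (wp _ _ nac)) -ltNge wp 1?eq_sym // => /(_ isT isT) wgap.
set th := _ / _ in wgap.
have s0 : 0 <= u a - u c by rewrite subr_ge0.
have step : u a - u c <= D + th * (u a - u c).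
  have {1}-> : u a - u c = b a - b c
    + \sum_k (offdiag_weight T c k - offdiag_weight T a k) * u k.
    under eq_bigr do rewrite mulrBl.
    by rewrite sumrB {1}(uE a) {1}(uE c); ring.
  apply: lerD => //; apply: (le_trans gap); exact: ler_wpM2r.
have d3 : 0 < n%:R * M + (n%:R - 2) * m.
  by apply: addr_gt0; apply: mulr_gt0; lra.
have d4 : 0 < 2 * (n%:R - 2) * m by rewrite !mulr_gt0 //; lra.
rewrite mulrA ler_pdivlMr //.
have : (u a - u c) * (1 - th) <= D by lra.
have -> : 1 - th = 2 * (n%:R - 2) * m / (n%:R * M + (n%:R - 2) * m).
  by rewrite /th; field; rewrite lt0r_neq0.
by rewrite mulrA ler_pdivrMr.
Qed.

(** * Invertibility of [T] and the product [S T] *)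

Lemma sum_row_balanced (R : fieldType) (n : nat) (T : 'M[R]_n) (i : 'I_n) :
    (forall i j, T i j = T j i) ->
    (forall j, T j j = \sum_(k | k != j) T k j) ->
  \sum_j T i j = 2 * T i i.
Proof.
move=> Ts Td; rewrite (bigD1 i) //= [in RHS]mulr_natl mulr2n; congr (_ + _).
by rewrite Td; apply: eq_bigr => k _.
Qed.

(** If [u T = 0], then [solution_spread] with [D = 0] makes [u] constant, and column [j] reads
    [u_j * (2 * T j j) = 0]. *)
Lemma balanced_unitmx (R : realFieldType) (n : nat) (T : 'M[R]_n) (m M : R) :
    (3 <= n)%N -> 0 < m -> (forall k j, k != j -> m <= T k j <= M) ->
    (forall j, T j j = \sum_(k | k != j) T k j) ->
    (forall j, 0 < T j j) ->
  T \in unitmx.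
Proof.
move=> n3 m0 Tb Td T0; rewrite -row_free_unit; apply: inj_row_free => u uT.
have uT0 j : \sum_k u 0 k * T k j = 0.
  by have /matrixP/(_ 0 j) := uT; rewrite !mxE.
have uc j l : u 0 j <= u 0 l.
  rewrite -subr_le0.
  have := @solution_spread R n T m M 0 (u 0) (fun=> 0) n3 m0 Tb Td T0 _ _ j l.
  by rewrite mul0r; apply=> *; rewrite ?mulr0 ?subrr.
apply/rowP => j; rewrite mxE; have := uT0 j.
have uE k : u 0 k = u 0 j by apply: le_anti; rewrite !uc.
under eq_bigr => k _ do rewrite uE.
rewrite -mulr_sumr (bigD1 j) //= -Td => /eqP; rewrite mulf_eq0.
by case/orP => /eqP // e; have := T0 j; lra.
Qed.

Lemma mulmx_approx_inv (R : realType) (n : nat) (T : 'M[R]_n) (i j : 'I_n) :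
  \sum_k approx_inv T i k * T k j
    = T i j / T i i - (\sum_k T k j) / offdiag_sum T.
Proof.
under eq_bigr do rewrite mxE mulrBl.
rewrite sumrB; congr (_ - _); last first.
  by rewrite mulr_suml; apply: eq_bigr => k _; ring.
rewrite (bigD1 i) //= eqxx big1 ?addr0; first by rewrite mulr1n; ring.
by move=> k; rewrite eq_sym => /negbTE ->; rewrite !mul0r.
Qed.

Lemma offdiag_sum_balanced (R : realType) (n : nat) (T : 'M[R]_n) :
  (forall i, T i i = \sum_(j | j != i) T i j) ->
  offdiag_sum T = \sum_i T i i.
Proof.
move=> Td; apply: eq_bigr => i _; rewrite Td [RHS]big_mkcond.
apply: eq_bigr => j _; rewrite eq_sym.
by case: eqP; rewrite ?subrr ?mul0r ?subr0 ?mul1r.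
Qed.

(** * Extreme off-diagonal entries *)

Lemma offdiag_bounds (R : realType) (n : nat) (T : 'M[R]_n) (i j : 'I_n) :
    (forall i j, T i j = T j i) -> i != j ->
  offdiag_min T <= T i j <= offdiag_max T.
Proof.
move=> Ts; wlog ij : i j / (i < j)%N => [hw|_].
  case: (ltngtP i j) => [/hw//|ji _|/val_inj->]; last by rewrite eqxx.
  by rewrite Ts; apply: hw => //; rewrite -val_eqE ltn_eqF.
have Tij : T i j \in upper_entries T.
  by apply/mapP; exists (i, j) => //; rewrite mem_filter ij mem_enum.
apply/andP; split; first exact: ge_bigmin_seq.
exact: (@le_bigmax_seq _ _ _ _ _ (T i j) xpredT id).
Qed.

Lemma offdiag_min_gt0 (R : realType) (n : nat) (T : 'M[R]_n) :
    (1 < n)%N -> (forall i j, 0 < T i j) ->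
  0 < offdiag_min T.
Proof.
move=> n1 T0.
have pos x : x \in upper_entries T -> 0 < x by case/mapP => p _ ->.
have n0 : (0 < n)%N by apply: leq_trans n1.
(* A member of the list rules out the junk minimum 0 of the empty list. *)
have : T (Ordinal n0) (Ordinal n1) \in upper_entries T.
  apply/mapP; exists (Ordinal n0, Ordinal n1) => //.
  by rewrite mem_filter mem_enum.
rewrite /offdiag_min /list_min; case: (upper_entries T) pos => // y s pos _ /=.
rewrite big_seq; elim/big_ind: _ => [|x z|]; first exact/pos/mem_head.
  by rewrite lt_min => -> ->.
exact: pos.
Qed.

(** * The entrywise estimate *)

Theorem theorem1 (R : realType) (n : nat) (T : 'M[R]_n)
    (n_ge3 : (3 <= n)%N)
    (T_sym : forall i j : 'I_n, T i j = T j i)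
    (T_pos : forall i j : 'I_n, 0 < T i j)
    (T_diag : forall i : 'I_n, T i i = \sum_(j < n | j != i) T i j) :
  let m := offdiag_min T in
  let M := offdiag_max T in
  mx_norm (invmx T - approx_inv T)
    <= bound_const n m M / (n%:R - 1) ^+ 2 + 1 / (2 * m * (n%:R - 1) ^+ 2).
Proof.
cbv zeta; set m := offdiag_min T; set M := offdiag_max T.
have m0 : 0 < m by apply: offdiag_min_gt0 => //; apply: leq_trans n_ge3.
have Tb k j : k != j -> m <= T k j <= M by apply: offdiag_bounds.
have Td j : T j j = \sum_(k | k != j) T k j.
  by rewrite T_diag; apply: eq_bigr.
have T0 j : 0 < T j j by [].
have n2 : 2 < n%:R :> R by rewrite (ltr_nat R 2).
have n10 : (0 < n)%N by apply: leq_trans n_ge3.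
have mM : m <= M.
  have i1 : (1 < n)%N by apply: leq_trans n_ge3.
  by have /andP[h1 h2] := Tb (Ordinal i1) (Ordinal n10) isT; apply: le_trans h2.
have Tge j : (n%:R - 1) * m <= T j j.
  have := @natr_card_D1 R n predT j isT; rewrite card_ord => <-.
  by rewrite Td; apply: sum_card_ge => k /Tb/andP[].
set d := offdiag_sum T.
have dE : d = \sum_j T j j by apply: offdiag_sum_balanced.
have dge : n%:R * ((n%:R - 1) * m) <= d.
  have := @sum_card_ge _ _ predT (fun j => T j j) _ (fun j _ => Tge j).
  by rewrite card_ord dE.
have n1 : 0 < n%:R - 1 :> R by lra.
have nm0 : 0 < (n%:R - 1) * m by apply: mulr_gt0.
have d0 : 0 < d by apply: lt_le_trans dge; apply: mulr_gt0; lra.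
have Tu : T \in unitmx by apply: balanced_unitmx Tb Td T0.
set F := invmx T - approx_inv T.
have FT i j : \sum_k F i k * T k j
    = (i == j)%:R - T i j / T i i + 2 * T j j / d.
  have FE k : F i k * T k j = invmx T i k * T k j - approx_inv T i k * T k j.
    by rewrite -mulrBl; congr (_ * _); rewrite !mxE.
  under eq_bigr do rewrite FE.
  have /matrixP/(_ i j) := mulVmx Tu; rewrite sumrB mulmx_approx_inv !mxE => ->.
  have -> : \sum_k T k j = 2 * T j j.
    by rewrite -sum_row_balanced //; apply: eq_bigr.
  by rewrite opprB addrA addrAC.
(* Row [i] of [F T] sums to [1 - 2 + 2 = 1] by [FT], and also to twice this weighted sum, since each
   row of [T] sums to twice its diagonal entry. *)
have Favg i : \sum_k F i k * T k k = 1 / 2.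
  have : \sum_j \sum_k F i k * T k j = 1.
    under eq_bigr do rewrite FT.
    rewrite !big_split /= -mulr_suml -mulr_sumr -dE sumrN -mulr_suml.
    rewrite sum_row_balanced // (bigD1 i) //= eqxx big1 ?addr0.
      by rewrite mulr1n; field; rewrite !lt0r_neq0.
    by move=> k; rewrite eq_sym => /negbTE ->.
  rewrite exchange_big /=.
  under eq_bigr do rewrite -mulr_sumr sum_row_balanced //.
  under eq_bigr do rewrite mulrCA; rewrite -mulr_sumr; lra.
have M0 : 0 < M by apply: lt_le_trans mM.
pose D := M / (((n%:R - 1) * m) * ((n%:R - 1) * m)).
have Fsp i j l : F i j - F i l <= bound_const n m M / (n%:R - 1) ^+ 2.
  (* This is [b_k] without the constant [2 / d], which cancels in differences. It is 0 at [k = i]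
     and lies in [[-D, 0]] elsewhere, so [D] bounds the spread. *)
  pose g k := ((i == k)%:R - T i k / T i i) / T k k.
  have -> : bound_const n m M / (n%:R - 1) ^+ 2
      = D * ((n%:R * M + (n%:R - 2) * m) / (2 * (n%:R - 2) * m)).
    by rewrite /bound_const /D; field; rewrite !lt0r_neq0 //; lra.
  have gb k : - D <= g k <= 0.
    rewrite /g; case: eqVneq => [<-|ik].
      rewrite divff ?lt0r_neq0 // subrr mul0r lexx andbT oppr_le0.
      by rewrite /D divr_ge0 ?(ltW M0) ?(ltW (mulr_gt0 nm0 nm0)).
    rewrite sub0r mulNr lerN2 oppr_le0 -mulrA -invfM; apply/andP; split.
      have /andP[_ hM] := Tb _ _ ik.
      apply: ler_pM => //; first exact: ltW.
        by rewrite invr_ge0 ltW ?mulr_gt0.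
      rewrite lef_pV2 ?posrE ?mulr_gt0 //.
      by apply: ler_pM => //; apply: ltW.
    by rewrite ltW // divr_gt0 // mulr_gt0.
  apply: (@solution_spread R n T m M D (F i) (fun k => g k + 2 / d)) => //.
    by move=> k; rewrite FT /g; field; rewrite !lt0r_neq0.
  move=> k k'; have := gb k; have := gb k'; lra.
set sp := bound_const n m M / _ in Fsp *.
(* The weights [T k k] sum to [d], so bounding each difference by [sp] places [F i j] within [sp] of
   the mean [1 / (2 * d)]. *)
have davg i j : d * F i j - 1 / 2 = \sum_k T k k * (F i j - F i k).
  under eq_bigr do rewrite mulrBr.
  rewrite sumrB -mulr_suml -dE -(Favg i); congr (_ - _).
  by apply: eq_bigr => k _; rewrite mulrC.
have inv_d : 1 / (2 * d) <= 1 / (2 * m * (n%:R - 1) ^+ 2).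
  rewrite !div1r lef_pV2 ?posrE ?mulr_gt0 ?exprn_gt0 //.
  apply: (@le_trans _ _ (2 * (n%:R * ((n%:R - 1) * m)))); last by lra.
  rewrite -subr_ge0.
  have -> : 2 * (n%:R * ((n%:R - 1) * m)) - 2 * m * (n%:R - 1) ^+ 2
    = 2 * ((n%:R - 1) * m) by ring.
  lra.
have d'0 : 0 < 1 / (2 * d) by rewrite divr_gt0 ?mulr_gt0.
have sp0 : 0 <= sp.
  by have := Fsp (Ordinal n10) (Ordinal n10) (Ordinal n10); rewrite subrr.
(* The maximum starts from 0, so the bound must also be shown nonnegative. *)
rewrite mx_normrE; apply: bigmax_le => [|[i j] _ /=]; first by lra.
have dd : d * (1 / (2 * d)) = 1 / 2 by field; rewrite lt0r_neq0.
have up : F i j <= sp + 1 / (2 * d).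
  rewrite -(ler_pM2l d0) mulrDr dd -lerBlDr davg dE mulr_suml.
  by apply: ler_sum => k _; apply: ler_wpM2l (Fsp _ _ _); apply: ltW.
have lo : - sp + 1 / (2 * d) <= F i j.
  rewrite -(ler_pM2l d0) mulrDr dd -lerBrDr davg dE mulr_suml.
  apply: ler_sum => k _; apply: ler_wpM2l; first exact: ltW.
  by rewrite lerNl opprB.
by rewrite ler_norml; apply/andP; split; lra.
Qed.
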